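(* Let $X$ be a finite-dimensional Euclidean or Hermitian space. For nonzero $p$-blades $A,B\in\bigwedge^p X$ with $[A]\neq[B]$, either: (i) $\dim([A]\cap[B])+1=p=\dim([A]+[B])-1$, and $A+B$ is simple but the sum $A+B$ is neither inner nor outer balanced; or (ii) $\dim([A]\cap[B])+2\le p\le\dim([A]+[B])-2$, and $A+B$ is not simple but the sum $A+B$ is balanced.
   Context: $X$ is a Euclidean (real) or Hermitian (complex) inner product space of finite dimension, with product $\langle\cdot,\cdot\rangle$ (conjugate-linear in the first argument in the complex case), and $\bigwedge X$ is its exterior algebra with the induced inner product (different grades orthogonal, $\langle x_1\wedge\cdots\wedge x_p,y_1\wedge\cdots\wedge y_p\rangle=\det(\langle x_i,y_j\rangle)$). The left contraction $M\lrcorner N$ is defined by $\langle L,M\lrcorner N\rangle=\langle M\wedge L,N\rangle$ for all $L$. A $p$-blade is an exterior product $v_1\wedge\cdots\wedge v_p$ of $p$ vectors (a scalar if $p=0$); simple means being a blade. For a nonzero blade $B=v_1\wedge\cdots\wedge v_p$, $[B]=\mathrm{span}\{v_1,\ldots,v_p\}$; $[\lambda]=\{0\}$ for a scalar $\lambda$. Inner and outer spaces: $\lfloor M\rfloor=\{v\in X:v\wedge M=0\}$, $\lceil M\rceil=\{v\in X:v\lrcorner M=0\}^\perp$; for nonzero blades both equal $[B]$. A sum $M=\sum_iM_i$ is inner balanced if $\lfloor M\rfloor=\bigcap_i\lfloor M_i\rfloor$, outer balanced if $\lceil M\rceil=\sum_i\lceil M_i\rceil$, and balanced if both hold. *)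

(* Defs.v *)
From HB Require Import structures.
From mathcomp Require Import all_boot all_order all_algebra all_field.
From mathcomp Require Import sesquilinear complex.
From mathcomp Require Import boolp classical_sets reals.

Set Implicit Arguments.
Unset Strict Implicit.
Unset Printing Implicit Defensive.

Import Order.TTheory GRing.Theory Num.Theory.

Local Open Scope ring_scope.
Local Open Scope classical_set_scope.

Inductive geometry := Euclidean | Hermitian.

Definition scalar_field (R : realType) (k : geometry) : numFieldType :=
  if k is Euclidean then R else complex R.

Definition conj_scalar (R : realType) (k : geometry) :
    {rmorphism scalar_field R k -> scalar_field R k} :=
  match k return {rmorphism scalar_field R k -> scalar_field R k} with
  | Euclidean => idfun
  | Hermitian => @Num.conj (complex R)
  end.

Arguments conj_scalar : clear implicits.

(* A form [dot : {dot V for theta}] of the library is linear in its first     *)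
(* argument and theta-linear in the second. The products here are             *)
(* conjugate-linear in the first argument, so the arguments are swapped.      *)
Definition inner (K : numFieldType) (theta : K -> K) (V : lmodType K)
    (dot : {dot V for theta}) (u v : V) : K := dot v u.

(* The exterior algebra of the inner product space (X, dot), given by its     *)
(* universal property: the exterior product is the product of the algebra,    *)
(* [ext_in] is the inclusion of the vectors, and an empty product is 1.       *)
Record exteriorAlgebra (K : numFieldType) (theta : K -> K)
    (X : vectType K) (dot : {dot X for theta}) := ExteriorAlgebra {
  ext_alg :> falgType K;
  ext_in : {linear X -> ext_alg};
  ext_in_sqr : forall v : X, ext_in v * ext_in v = 0;
  ext_universal : forall (A : algType K) (f : {linear X -> A}),
    (forall v : X, f v * f v = 0) ->
    exists g : {lrmorphism ext_alg -> A},
      (forall v : X, g (ext_in v) = f v) /\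
      (forall h : {lrmorphism ext_alg -> A},
         (forall v : X, h (ext_in v) = f v) -> h =1 g);
  ext_dot : {dot ext_alg for theta};
  ext_inner_grade : forall s t : seq X, size s != size t ->
    inner ext_dot (\prod_(x <- s) ext_in x) (\prod_(y <- t) ext_in y) = 0;
  ext_inner_det : forall (p : nat) (x y : 'I_p -> X),
    inner ext_dot (\prod_(i < p) ext_in (x i)) (\prod_(j < p) ext_in (y j))
      = \det (\matrix_(i, j) inner dot (x i) (y j))
}.

Section Multivectors.

Variables (K : numFieldType) (theta : {rmorphism K -> K}).
Variables (X : vectType K) (dot : {dot X for theta}).
Variable E : exteriorAlgebra dot.

Definition wedge (s : seq X) : E := \prod_(x <- s) ext_in E x.

Definition is_pblade (p : nat) (B : E) : Prop :=
  if p is 0 then exists c : K, B = c%:A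
  else exists v : p.-tuple X, B = wedge v.

Definition simple_mv (B : E) : Prop := exists p : nat, is_pblade p B.

(* [B]; see blade_space_wedge and blade_space_scalar below. The value is      *)
(* meaningful only for nonzero blades.                                        *)
Definition spanned_by (B : E) (V : {vspace X}) : Prop :=
  (exists c : K, B = c%:A /\ V = 0%VS) \/
  (exists v : seq X, B = wedge v /\ V = <<v>>%VS).

Definition blade_space (B : E) : {vspace X} := xget 0%VS (spanned_by B).

(* The left contraction of N by M; see lcontrP below. *)
Definition lcontr (M N : E) : E :=
  xget 0 [set P | forall L : E,
    inner (ext_dot E) L P = inner (ext_dot E) (M * L) N].

Definition inner_space (M : E) : set X := [set v | ext_in E v * M = 0].

Definition orthogonal_to (S : set X) : set X :=
  [set w | forall v : X, S v -> inner dot v w = 0].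

Definition outer_space (M : E) : set X :=
  orthogonal_to [set v | lcontr (ext_in E v) M = 0].

Definition inner_balanced (n : nat) (M : 'I_n -> E) : Prop :=
  inner_space (\sum_(i < n) M i) = \bigcap_(i in [set: 'I_n]) inner_space (M i).

Definition outer_balanced (n : nat) (M : 'I_n -> E) : Prop :=
  outer_space (\sum_(i < n) M i) =
  [set v | exists u : 'I_n -> X,
     (forall i, outer_space (M i) (u i)) /\ v = \sum_(i < n) u i].

Definition balanced (n : nat) (M : 'I_n -> E) : Prop :=
  inner_balanced M /\ outer_balanced M.

Definition pair_family (A B : E) (i : 'I_2) : E := if i == 0 then A else B.

End Multivectors.

Section Facts.

Variables (K : numFieldType) (theta : {rmorphism K -> K}).
Variables (X : vectType K) (dot : {dot X for theta}).
Variable E : exteriorAlgebra dot.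

Section Dot.
Variables (V : lmodType K) (d : {dot V for theta}).

Lemma dotDl u v w : d (u + v) w = d u w + d v w. Proof. exact: linearDl. Qed.
Lemma dotDr u v w : d u (v + w) = d u v + d u w. Proof. exact: linearDr. Qed.
Lemma dotZl a u v : d (a *: u) v = a * d u v. Proof. exact: linearZl_LR. Qed.
Lemma dotZr a u v : d u (a *: v) = theta a * d u v.
Proof. exact: linearZr_LR. Qed.
Lemma dot0l v : d 0 v = 0. Proof. exact: linear0l. Qed.
Lemma dot0r v : d v 0 = 0. Proof. exact: linear0r. Qed.

Lemma dot_eq0 (u : V) : d u u = 0 -> u = 0.
Proof.
move=> duu; apply/eqP; case: eqVneq => // /(neq0_dnorm_gt0 (s:=d)).
by rewrite duu ltxx.
Qed.
End Dot.

Lemma riesz (V : vectType K) (d : {dot V for theta}) (Q : V -> K) :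
  (forall u v, Q (u + v) = Q u + Q v) ->
  (forall a u, Q (a *: u) = theta a * Q u) -> exists P, forall u, d P u = Q u.
Proof.
move=> QD QZ; pose e := vbasis (fullv : {vspace V}).
have Q0 : Q 0 = 0 by rewrite -(scale0r 0) QZ rmorph0 mul0r.
have ext P : (forall j : 'I_(\dim {:V}), d P e`_j = Q e`_j) -> d P =1 Q.
  move=> eqe u; rewrite (coord_vbasis (memvf u)).
  apply: (big_ind (fun w => d P w = Q w)) => [|x y dx dy|j _].
  - by rewrite dot0r Q0.
  - by rewrite dotDr QD dx dy.
  by rewrite dotZr QZ eqe.
pose h (P : V) : 'rV[K]_(\dim {:V}) := \row_j d P e`_j.
have hl : linear h.
  by move=> a u v; apply/rowP=> j; rewrite !mxE dotDl dotZl.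
pose hL := GRing.isLinear.Build _ _ _ _ h hl.
pose H : {linear V -> 'rV[K]_(\dim {:V})} := HB.pack h hL.
have Hi : lker (linfun H) = 0%VS.
  apply/eqP; rewrite -subv0; apply/subvP => P; rewrite memv_ker lfunE /= memv0.
  move=> /eqP/rowP hP; apply/eqP/(dot_eq0 (d := d)).
  have dP : d P =1 fun=> 0.
    move=> u; rewrite (coord_vbasis (memvf u)).
    apply: (big_ind (fun w => d P w = 0)) => [|x y dx dy|j _].
    - by rewrite dot0r.
    - by rewrite dotDr dx dy addr0.
    by have := hP j; rewrite dotZr !mxE => ->; rewrite mulr0.
  exact: dP.
have Hs : limg (linfun H) = fullv.
  apply/eqP; rewrite eqEdim subvf /= limg_dim_eq; last by rewrite Hi capv0.
  by rewrite !dimvf /dim /= mul1n.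
have : \row_j Q e`_j \in limg (linfun H) by rewrite Hs memvf.
case/memv_imgP=> P _; rewrite lfunE /= => /rowP HP.
by exists P; apply: ext => j; have := HP j; rewrite !mxE.
Qed.

Lemma lcontrP (M N L : E) :
  inner (ext_dot E) L (lcontr M N) = inner (ext_dot E) (M * L) N.
Proof.
rewrite /lcontr; case: xgetP => [P _ /(_ L)//|].
have [P PE] := @riesz E (ext_dot E) (fun u => ext_dot E N (M * u))
  (fun u v => etrans (congr1 _ (mulrDr M u v)) (dotDr _ _ _ _))
  (fun a u => etrans (congr1 _ (esym (scalerAr a M u))) (dotZr _ _ _ _)).
by move=> /(_ P); case=> u; exact: PE.
Qed.

Lemma wedge_cons x s : wedge E (x :: s) = ext_in E x * wedge E s.
Proof. by rewrite /wedge big_cons. Qed.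

Lemma wedgeE s : wedge E s = \prod_(i < size s) ext_in E s`_i.
Proof. by rewrite /wedge (big_nth 0) big_mkord. Qed.

Lemma ext_inC u v : ext_in E u * ext_in E v = - (ext_in E v * ext_in E u).
Proof.
apply/eqP; rewrite -addr_eq0; have := ext_in_sqr E (u + v).
by rewrite linearD mulrDr !mulrDl !ext_in_sqr add0r addr0 addrC => ->.
Qed.

Lemma mem_wedge0 x s : x \in s -> ext_in E x * wedge E s = 0.
Proof.
elim: s => // y s IH; rewrite inE wedge_cons mulrA => /orP[/eqP->|/IH xs].
  by rewrite ext_in_sqr mul0r.
by rewrite ext_inC mulNr -mulrA xs mulr0 oppr0.
Qed.

Lemma free_wedge_neq0 s : free s -> wedge E s != 0.
Proof.
move=> fs; apply/eqP => w0.
pose G := \matrix_(i < size s, j < size s) inner dot s`_i s`_j.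
have : \det G^T = 0.
  by rewrite det_tr -(ext_inner_det E) -wedgeE w0 /inner dot0r.
move/eqP/det0P => [c /eqP c0 /rowP cG]; apply: c0.
pose u := \sum_(i < size s) c 0 i *: s`_i.
have us (j : 'I_(size s)) : dot u s`_j = 0.
  have := cG j; rewrite !mxE => <-.
  rewrite /u (big_morph (fun w => dot w s`_j) (fun v w => dotDl dot v w _)
    (dot0l dot _)).
  by apply: eq_bigr => i _; rewrite !mxE dotZl.
have u0 : u = 0.
  apply: (@dot_eq0 _ dot); rewrite {2}/u.
  apply: (big_ind (fun w => dot u w = 0)) => [|x y dx dy|j _].
  - by rewrite dot0r.
  - by rewrite dotDr dx dy addr0.
  by rewrite dotZr us mulr0.
have ci : forall i, c 0 i = 0.
  by apply: (elimT (freeP (X := in_tuple s)) fs (c 0)).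
by apply/rowP => i; rewrite ci mxE.
Qed.

Lemma free_of_wedge_neq0 s : wedge E s != 0 -> free s.
Proof.
elim: s => [|x s IH]; first by rewrite nil_free.
rewrite wedge_cons free_cons => xs0.
rewrite IH ?andbT; last by apply: contraNneq xs0 => ->; rewrite mulr0.
apply: contraNN xs0 => /(coord_span (X:=in_tuple s)) -> ; rewrite linear_sum mulr_suml big1 // => i _.
by rewrite linearZ -scalerAl mem_wedge0 ?scaler0 // mem_nth.
Qed.

Lemma mem_span_wedge s x : wedge E s != 0 ->
  (x \in <<s>>%VS) = (ext_in E x * wedge E s == 0).
Proof.
move=> s0; apply/idP/eqP => [/(coord_span (X:=in_tuple s)) ->|].
  rewrite linear_sum mulr_suml big1 // => i _.
  by rewrite linearZ -scalerAl mem_wedge0 ?scaler0 // mem_nth.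
rewrite -wedge_cons => /eqP; apply: contraTT => xs.
by apply: free_wedge_neq0; rewrite free_cons xs free_of_wedge_neq0.
Qed.

Lemma spanned_by_unique (B : E) (V W : {vspace X}) : B != 0 ->
  spanned_by B V -> spanned_by B W -> V = W.
Proof.
have key (U : {vspace X}) : B != 0 -> spanned_by B U ->
    forall x, (x \in U) = (ext_in E x * B == 0).
  move=> B0 [[c [Bc ->]]|[s [Bs ->]]] x; last first.
    by rewrite Bs mem_span_wedge // -Bs.
  rewrite Bc memv0 -scalerAr mulr1 scaler_eq0.
  have /negPf -> /= : c != 0 by apply: contraNneq B0 => c0; rewrite Bc c0 scale0r.
  apply/eqP/eqP => [->|]; first exact: linear0.
  have := @free_wedge_neq0 [:: x]; rewrite wedge_cons /wedge big_nil mulr1.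
  by rewrite seq1_free; case: (eqVneq x 0) => // _ /(_ isT)/eqP.
by move=> B0 BV BW; apply/vspaceP => x; rewrite (key V) // (key W).
Qed.

Lemma blade_space_wedge (v : seq X) :
  wedge E v != 0 -> blade_space (wedge E v) = <<v>>%VS.
Proof.
move=> v0; apply: xget_unique; first by right; exists v.
by move=> V VB; apply: (spanned_by_unique v0 VB); right; exists v.
Qed.

Lemma blade_space_scalar (c : K) :
  c != 0 -> blade_space (c%:A : E) = 0%VS.
Proof.
move=> c0; have cA0 : (c%:A : E) != 0 by rewrite scaler_eq0 oner_eq0 orbF.
apply: xget_unique; first by left; exists c.
by move=> V VB; apply: (spanned_by_unique cA0 VB); left; exists c.
Qed.

End Facts.

(* Main.v *)
Require Import Defs.
From HB Require Import structures.
From mathcomp Require Import all_boot all_order all_algebra all_field.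
From mathcomp Require Import sesquilinear classical_sets reals.

(* The inner and the outer space of a nonzero blade both equal its space, so  *)
(* a balanced sum A + B is not simple: its inner space is [A] :&: [B] and its *)
(* outer space is the larger [A] + [B]. If dim ([A] :&: [B]) <= p - 2, then   *)
(* v ^ A and - v ^ B, when nonzero, are blades with different spaces, and so  *)
(* are the contractions v -| A and - (v -| B); hence v annihilates A + B only *)
(* if it annihilates both blades. If the dimension is p - 1, then A = x ^ D   *)
(* and B = y ^ D up to scalars, and A + B is a blade, whose space lies        *)
(* strictly between [A] :&: [B] and [A] + [B].                                *)

(** A vector v annihilates a nonzero blade A under the exterior product iff v lies in [A]
    ([mem_span_wedge]), and under contraction iff v is orthogonal to [A] ([lcontr_wedge_eq0]). So A
    + B is balanced unless the terms for A and B cancel. Cancelling exterior products need a space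
    of dimension p + 1 containing [A] + [B]; cancelling contractions need one of dimension p - 1
    inside [A] :&: [B]. Since the dimensions of sum and intersection add up to 2p, both force dim
    ([A] :&: [B]) = p - 1 ([far_wedge_eq0], [far_lcontr_eq0]); in that case the common factor is
    pulled out ([adjacent_blades]). The contraction is known only by adjunction. It is computed by
    testing against exterior products, which span the algebra ([wedges_span]) and whose inner
    products are Gram determinants. *)

Set Implicit Arguments.
Unset Strict Implicit.
Unset Printing Implicit Defensive.

Import Order.TTheory GRing.Theory Num.Theory.

Local Open Scope ring_scope.

(** * Exterior products of vectors span the algebra *)

Section Wedges.

Variables (K : numFieldType) (theta : {rmorphism K -> K}).
Variables (X : vectType K) (dot : {dot X for theta}).
Variable E : exteriorAlgebra dot.

Local Notation vecs := (limg (linfun (ext_in E))).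

(* The universal property retracts the algebra onto the subalgebra generated  *)
(* by the vectors, and by uniqueness this retraction is the identity.         *)
Lemma agenv_vectors : agenv vecs = fullv.
Proof.
pose A := agenv_aspace vecs.
have inA v : ext_in E v \in A.
  by rewrite (subvP (sub_agenv _)) // -(lfunE (ext_in E)) memv_img ?memvf.
(* A subalgebra may have a unit of its own; sharing that of [E] makes [h] below unital. *)
have A1 : algid A = 1.
  by apply/eqP; rewrite algid_eq1 memvE sub1_agenv.
pose f : {linear X -> subvs_of A} := vsproj A \o ext_in E.
have vf v : vsval (f v) = ext_in E v by rewrite /= vsprojK.
have ff v : f v * f v = 0.
  by apply: val_inj; rewrite /= vsprojK // ext_in_sqr.
have [g [gf _]] := @ext_universal _ _ _ _ E _ f ff.
pose h := vsval \o g.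
have hl : linear h by move=> a u v; rewrite /h /= linearP.
have hm : monoid_morphism h.
  by split=> [|u v]; rewrite /h /= ?rmorph1 ?rmorphM //= A1.
pose hl' := GRing.isLinear.Build _ _ _ _ h hl.
pose hm' := GRing.isMonoidMorphism.Build _ _ h hm.
pose H : {lrmorphism E -> E} := HB.pack h hl' hm'.
(* [i] is the only endomorphism fixing the vectors, so both [H] and the identity equal it. *)
have [i [_ iU]] := @ext_universal _ _ _ _ E _ _ (ext_in_sqr E).
have Hi : H =1 i by apply: iU => v; rewrite /= /h /= gf vf.
have idi : idfun =1 i by apply: (iU (idfun : {lrmorphism E -> E})).
have hE L : vsval (g L) = L by rewrite -[LHS]/(H L) Hi -idi.
by apply/vspaceP => L; rewrite memvf -(hE L) subvsP.
Qed.

(** The generated algebra is a finite sum of powers of the space of vectors, and products of basis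
    vectors span each power; hence a finite list suffices. *)
Lemma wedges_span : exists ss : seq (seq X), <<map (wedge E) ss>>%VS = fullv.
Proof.
have pow n : exists ss : seq (seq X),
    (vecs ^+ n <= <<map (wedge E) ss>>)%VS.
  elim: n => [|n [ss IH]].
    exists [:: [::]]; rewrite expv0 -memvE memv_span //=.
    by rewrite /wedge big_nil mem_head.
  exists [seq x :: s | x <- vbasis (fullv : {vspace X}), s <- ss].
  rewrite expvSl; apply: (subv_trans (prodvSr _ IH)).
  apply/prodvP => _ L /memv_imgP[x _ ->] /(coord_span (X:=in_tuple _)) ->.
  rewrite lfunE /= (coord_vbasis (memvf x)) linear_sum mulr_suml.
  apply: memv_suml => i _; rewrite mulr_sumr; apply: memv_suml => j _.
  rewrite linearZ -scalerAl -scalerAr; do 2!apply: memvZ.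
  apply: memv_span.
  have [js] : (j < size ss)%N by case: j => j /=; rewrite size_map.
  rewrite (nth_map [::]) // -wedge_cons map_f //.
  by apply: allpairs_f; rewrite mem_nth // size_tuple.
suff [ss sS] : exists ss : seq (seq X),
    (agenv vecs <= <<map (wedge E) ss>>)%VS.
  by exists ss; apply/eqP; rewrite eqEsubv subvf -agenv_vectors.
rewrite /agenv; elim: (\dim _) => [|n [s1 IH]].
  by exists [::]; rewrite big_ord0 sub0v.
have [s2 s2P] := pow n.
by exists (s1 ++ s2); rewrite big_ord_recr /= map_cat span_cat addvS.
Qed.

(** P - Q is orthogonal to a spanning family, hence to itself. *)
Lemma inner_wedge_ext (P Q : E) :
  (forall s, inner (ext_dot E) (wedge E s) P =
             inner (ext_dot E) (wedge E s) Q) -> P = Q.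
Proof.
move=> PQ; apply/subr0_eq/(dot_eq0 (d := ext_dot E)).
have [ss ssP] := wedges_span.
have : P - Q \in <<map (wedge E) ss>>%VS by rewrite ssP memvf.
move=> /(coord_span (X:=in_tuple _)) {2}->.
apply: (big_ind (fun w => ext_dot E (P - Q) w = 0)) => [|x y dx dy|j _].
- by rewrite dot0r.
- by rewrite dotDr dx dy addr0.
have [js] : (j < size ss)%N by case: j => j /=; rewrite size_map.
rewrite dotZr (nth_map [::]) //; move: (PQ (nth [::] ss j)); rewrite /inner => e.
by rewrite linearBl /= e subrr mulr0.
Qed.

End Wedges.

(** * Orthogonal projection and double orthogonal complement *)

Section Orthogonality.

Local Open Scope classical_set_scope.

Variables (K : numFieldType) (theta : {rmorphism K -> K}).
Variables (X : vectType K) (dot : {dot X for theta}).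
Implicit Types (U V : {vspace X}) (v w : X).

Lemma mem_orthovD U V v :
  (v \in orthov dot (U + V)) = (v \in orthov dot U) && (v \in orthov dot V).
Proof. by rewrite !memvE orthovD. Qed.

Lemma orthogonal_projection (s : seq X) v :
  exists2 w, w \in <<s>>%VS & v - w \in orthov dot <<s>>.
Proof.
elim: s v => [|x s IH] v.
  by exists 0; rewrite ?mem0v // span_nil orthov0 memvf.
have [w0 w0s v's] := IH v; have [x0 x0s ys] := IH x.
set v' := v - w0 in v's; set y := x - x0 in ys.
(* Gram-Schmidt: [y] is the part of x orthogonal to s, and c *: y is the projection of [v'] on it.
   If y = 0, this projection is 0 whatever [c] is. *)
pose c := dot v' y / dot y y.
have ysx : y \in <<x :: s>>%VS.
  rewrite span_cons memvB //; last by rewrite (subvP (addvSr _ _)).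
  by rewrite (subvP (addvSl _ _)) ?memv_line.
have zs : v' - c *: y \in orthov dot <<s>> by rewrite memvB ?memvZ.
exists (w0 + c *: y).
  by rewrite memvD ?memvZ // span_cons (subvP (addvSr _ _)).
rewrite opprD addrA -/v' span_cons mem_orthovD zs andbT mem_orthov1.
have -> : x = y + x0 by rewrite subrK.
rewrite -[X in X == 0]/(dot _ _) dotDr.
have -> : dot (v' - c *: y) x0 = 0 by exact: (mem_orthovP zs).
rewrite addr0 dotDl -scaleNr dotZl mulNr subr_eq0 /c.
have [-> | y0] := eqVneq y 0; first by rewrite !dot0r mulr0.
by rewrite divfK //; apply: contraNneq y0 => /dot_eq0 ->.
Qed.

(** If w is the projection of v on U, then v - w is orthogonal to w, and also to v when v is
    orthogonal to the complement of U; so v = w. Outer spaces, defined as complements, are computed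
    this way. *)
Lemma orthogonal_to_orthov U :
  orthogonal_to dot [set v | v \in orthov dot U] = [set v | v \in U].
Proof.
apply/seteqP; split => v /= => [vU|vU w wU]; last first.
  by apply/eqP; rewrite /inner (herm_eq0C dot); apply/eqP/(mem_orthovP wU).
have [w] := orthogonal_projection (vbasis U) v.
rewrite (span_basis (vbasisP U)) => wU vwU.
have : dot (v - w) (v - w) = 0.
  have -> : dot (v - w) (v - w) = dot (v - w) v - dot (v - w) w.
    exact: linearBr.
  have -> : dot (v - w) w = 0 by exact: (mem_orthovP vwU).
  rewrite subr0; apply/eqP.
  by rewrite (herm_eq0C dot); apply/eqP/vU.
by move=> /dot_eq0/subr0_eq ->.
Qed.

End Orthogonality.

(** * Left contraction by a vector *)

Section Contraction.

Variables (K : numFieldType) (theta : {rmorphism K -> K}).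
Variables (X : vectType K) (dot : {dot X for theta}).
Variable E : exteriorAlgebra dot.
Implicit Types (s t : seq X) (v w : X) (M N : E) (U : {vspace X}).

Lemma inner_wedge s t : size s = size t ->
  inner (ext_dot E) (wedge E s) (wedge E t) =
  \det (\matrix_(i < size s, j < size s) inner dot s`_i t`_j).
Proof. by move=> st; rewrite !wedgeE -st ext_inner_det. Qed.

Lemma lcontr_unique M N (P : E) :
  (forall s, inner (ext_dot E) (wedge E s) P =
             inner (ext_dot E) (M * wedge E s) N) -> lcontr M N = P.
Proof. by move=> PE; apply: inner_wedge_ext => s; rewrite lcontrP PE. Qed.

Lemma lcontrD M N P : lcontr M (N + P) = lcontr M N + lcontr M P.
Proof.
by apply: lcontr_unique => s; rewrite /inner !dotDl; congr (_ + _); exact: lcontrP.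
Qed.

Lemma lcontrZ M c N : lcontr M (c *: N) = c *: lcontr M N.
Proof.
by apply: lcontr_unique => s; rewrite /inner !dotZl; congr (_ * _); exact: lcontrP.
Qed.

Lemma lcontr_wedge_nil v : lcontr (ext_in E v) (wedge E [::]) = 0.
Proof.
apply: lcontr_unique => s; rewrite -wedge_cons {1}/inner dot0l.
by rewrite ext_inner_grade.
Qed.

(** The first row of the Gram determinant of v :: t against w :: s vanishes beyond its first entry,
    so Laplace expansion leaves one term. *)
Lemma lcontr_wedge_cons v w s : {in s, forall x, inner dot v x = 0} ->
  lcontr (ext_in E v) (wedge E (w :: s)) = inner dot v w *: wedge E s.
Proof.
move=> vs; apply: lcontr_unique => t; rewrite -wedge_cons.
rewrite {1}/inner dotZl -[ext_dot E _ _]/(inner _ (wedge E t) (wedge E s)).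
have [st|st] := eqVneq (size t) (size s); last by rewrite !ext_inner_grade ?mulr0.
rewrite !inner_wedge //= ?st // (expand_det_row _ ord0) big_ord_recl big1 ?addr0.
  rewrite !mxE /= /cofactor addn0 expr0 mul1r; congr (_ * \det _).
  by apply/matrixP => i j; rewrite !mxE.
by move=> i _; rewrite !mxE /= vs ?mul0r //; apply: mem_nth (ltn_ord i).
Qed.

End Contraction.

(** * Blades and their inner and outer spaces *)

Section Blades.

Local Open Scope classical_set_scope.

Variables (K : numFieldType) (theta : {rmorphism K -> K}).
Variables (X : vectType K) (dot : {dot X for theta}).
Variable E : exteriorAlgebra dot.
Implicit Types (s t : seq X) (v w : X) (M N : E) (U : {vspace X}).

(* Both sides have the same inner product with every product of p vectors, so *)
(* their difference has norm 0.                                               *)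
Lemma prod_ext_in_det p (x y : 'I_p -> X) (P : 'M[K]_p) :
  (forall i, x i = \sum_j P i j *: y j) ->
  \prod_(i < p) ext_in E (x i) = \det P *: \prod_(i < p) ext_in E (y i).
Proof.
move=> xy; apply/subr0_eq/(dot_eq0 (d := ext_dot E)).
set D := _ - _.
have orth z : ext_dot E D (\prod_(i < p) ext_in E (z i)) = 0.
  have -> : ext_dot E D (\prod_(i < p) ext_in E (z i)) =
      inner (ext_dot E) (\prod_(i < p) ext_in E (z i))
        (\prod_(i < p) ext_in E (x i)) -
      \det P * inner (ext_dot E) (\prod_(i < p) ext_in E (z i))
        (\prod_(i < p) ext_in E (y i)).
    by rewrite /D dotDl -scaleNr dotZl mulNr.
  rewrite !ext_inner_det; apply/eqP; rewrite subr_eq0; apply/eqP.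
  rewrite -(det_tr P) mulrC -det_mulmx; congr (\det _).
  apply/matrixP => i j; rewrite !mxE xy /inner.
  rewrite (big_morph (fun w => dot w (z i)) (fun v w => dotDl dot v w _)
    (dot0l dot _)).
  by apply: eq_bigr => k _; rewrite !mxE dotZl mulrC.
by rewrite {2}/D dotDr -scaleNr dotZr !orth mulr0 addr0.
Qed.

Lemma wedge_sub_span s t : size s = size t -> {subset s <= <<t>>%VS} ->
  exists c, wedge E s = c *: wedge E t.
Proof.
move=> st ssub; rewrite !wedgeE -st.
exists (\det (\matrix_(i, j < size s) coord (in_tuple t) (cast_ord st j) s`_i)).
apply: prod_ext_in_det => i.
rewrite [LHS](coord_span (X:=in_tuple t)); last exact/ssub/mem_nth.
rewrite (reindex (cast_ord st)) /=; last first.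
  by exists (cast_ord (esym st)) => j _; rewrite ?cast_ordK ?cast_ordKV.
by apply: eq_bigr => j _; rewrite mxE.
Qed.

Lemma wedge_eq_span s t : size s = size t -> <<s>>%VS = <<t>>%VS ->
  wedge E s != 0 -> exists2 c, c != 0 & wedge E s = c *: wedge E t.
Proof.
move=> st est s0; have [|c sc] := wedge_sub_span st.
  by move=> x xs; rewrite -est memv_span.
by exists c => //; apply: contraNneq s0 => c0; rewrite sc c0 scale0r.
Qed.

(** The blade is rewritten, up to a scalar, on a basis adapted to v: some w not orthogonal to v,
    followed by a basis of the hyperplane of [s] orthogonal to v. Contraction then just removes
    w. *)
Lemma lcontr_wedge s v : wedge E s != 0 -> v \notin orthov dot <<s>> ->
  exists c t, [/\ c != 0, wedge E t != 0,
    <<t>>%VS = (<<s>> :&: orthov dot <[v]>)%VS &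
    lcontr (ext_in E v) (wedge E s) = c *: wedge E t].
Proof.
move=> s0 vs; have fs := free_of_wedge_neq0 s0.
have /mem_orthovPn[w ws vw] := vs.
set U := (<<s>> :&: orthov dot <[v]>)%VS.
have dU : \dim U = (size s).-1 by rewrite /U -eq_dim_orthov1 // (eqP fs).
have wU : w \notin U.
  by rewrite memv_cap ws mem_orthov1 (herm_eq0C dot).
pose t : seq X := vbasis U.
have tU : <<t>>%VS = U := span_basis (vbasisP U).
have ft : free t := basis_free (vbasisP U).
have s_gt0 : (0 < size s)%N.
  case: (s) ws vw => //; rewrite span_nil memv0 => /eqP ->.
  by move/eqP=> []; exact: dot0r.
have sz : size s = size (w :: t) by rewrite /= size_tuple dU prednK.
have fwt : free (w :: t) by rewrite free_cons tU wU.
have est : <<s>>%VS = <<w :: t>>%VS.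
  apply/esym/eqP; rewrite eqEdim (eqP fs) (eqP fwt) sz leqnn andbT.
  rewrite span_cons subv_add tU -memvE ws.
  by rewrite /U capvSl.
have [c c0 ->] := wedge_eq_span sz est s0.
exists (c * inner dot v w), t; split => //.
- by rewrite mulf_neq0 // /inner (herm_eq0C dot).
- exact: free_wedge_neq0.
rewrite lcontrZ lcontr_wedge_cons ?scalerA // => x xt.
have : x \in U by rewrite -tU memv_span.
by rewrite memv_cap mem_orthov1 => /andP[_ /eqP].
Qed.

Lemma lcontr_wedge_orthov s v : v \in orthov dot <<s>> ->
  lcontr (ext_in E v) (wedge E s) = 0.
Proof.
move=> /mem_orthovP vs.
have vx x : x \in s -> inner dot v x = 0.
  by move=> /memv_span/vs/eqP; rewrite (herm_eq0C dot) => /eqP.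
case: s vx {vs} => [|w s] vx; first exact: lcontr_wedge_nil.
rewrite lcontr_wedge_cons ?vx ?mem_head ?scale0r // => x xs.
by rewrite vx // in_cons xs orbT.
Qed.

Lemma lcontr_wedge_eq0 s v : wedge E s != 0 ->
  (lcontr (ext_in E v) (wedge E s) == 0) = (v \in orthov dot <<s>>).
Proof.
move=> s0; apply/idP/idP => [|/lcontr_wedge_orthov ->//].
apply: contraTT => /(lcontr_wedge s0) [c [t [c0 t0 _ ->]]].
by rewrite scaler_eq0 negb_or c0.
Qed.

Lemma inner_space_wedge c s : c != 0 -> wedge E s != 0 ->
  inner_space (c *: wedge E s) = [set v | v \in <<s>>%VS].
Proof.
move=> c0 s0; apply/seteqP; split => v /=; rewrite (mem_span_wedge _ s0) /inner_space /=.
  by rewrite -scalerAr => /eqP; rewrite scaler_eq0 (negPf c0).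
by rewrite -scalerAr => /eqP ->; rewrite scaler0.
Qed.

Lemma outer_space_wedge c s : c != 0 -> wedge E s != 0 ->
  outer_space (c *: wedge E s) = [set v | v \in <<s>>%VS].
Proof.
move=> c0 s0; rewrite -(orthogonal_to_orthov dot) /outer_space.
congr orthogonal_to; apply/seteqP; split => v /=.
  by rewrite lcontrZ -lcontr_wedge_eq0 // => /eqP; rewrite scaler_eq0 (negPf c0).
by rewrite lcontrZ => /lcontr_wedge_orthov ->; rewrite scaler0.
Qed.

Lemma simple_mv_wedge M : simple_mv M -> M != 0 ->
  exists c s, [/\ c != 0, wedge E s != 0 & M = c *: wedge E s].
Proof.
case=> -[|p] /= [].
  move=> c -> cA; exists c, [::]; rewrite /wedge big_nil oner_neq0; split => //.
  by apply: contraNneq cA => ->; rewrite scale0r.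
by move=> s -> s0; exists 1, s; rewrite oner_neq0 scale1r.
Qed.

(** This is the obstruction used to refute simplicity. *)
Lemma simple_inner_outer_space M : simple_mv M -> M != 0 ->
  inner_space M = outer_space M.
Proof.
move=> /simple_mv_wedge/[apply] [[c [s [c0 s0 ->]]]].
by rewrite inner_space_wedge // outer_space_wedge.
Qed.

End Blades.

(** * The sum of two blades of the same grade with distinct spaces *)

Section PairOfBlades.

Local Open Scope classical_set_scope.

Variables (K : numFieldType) (theta : {rmorphism K -> K}).
Variables (X : vectType K) (dot : {dot X for theta}).
Variable E : exteriorAlgebra dot.
Implicit Types (U V : {vspace X}).

Lemma mem_vspace_inj U V :
  [set v | v \in U] = [set v | v \in V] -> U = V.
Proof.
move=> UV; apply/vspaceP => v; apply/idP/idP.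
  by rewrite -[is_true _]/([set v | v \in U] v) UV.
by rewrite -[is_true _]/([set v | v \in V] v) -UV.
Qed.

Lemma sum_pair_family (A B : E) : \sum_(i < 2) pair_family A B i = A + B.
Proof. by rewrite !big_ord_recl big_ord0 addr0. Qed.

Variables (s t : seq X) (p : nat).
Hypothesis sizes : size s = p.
Hypothesis sizet : size t = p.
Hypothesis s0 : wedge E s != 0.
Hypothesis t0 : wedge E t != 0.
Hypothesis neq_st : <<s>>%VS != <<t>>%VS.

Local Notation A := (wedge E s).
Local Notation B := (wedge E t).
Local Notation U := <<s>>%VS.
Local Notation V := <<t>>%VS.

Lemma inner_balanced_pairE : inner_balanced (pair_family A B) <->
  inner_space (A + B) = [set v | v \in (U :&: V)%VS].
Proof.
rewrite /inner_balanced sum_pair_family.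
suff -> : \bigcap_(i in [set: 'I_2]) inner_space (pair_family A B i) =
    [set v | v \in (U :&: V)%VS] by [].
have memU v : (v \in U) <-> ext_in E v * A = 0.
  by rewrite (mem_span_wedge _ s0); split => /eqP.
have memV v : (v \in V) <-> ext_in E v * B = 0.
  by rewrite (mem_span_wedge _ t0); split => /eqP.
apply/seteqP; split => v /=.
  move=> vAB; apply/memv_capP; split; first by apply/memU/(vAB 0).
  by apply/memV/(vAB 1).
by move=> /memv_capP[/memU vA /memV vB] i _; rewrite /pair_family; case: ifP.
Qed.

Lemma outer_balanced_pairE : outer_balanced (pair_family A B) <->
  outer_space (A + B) = [set v | v \in (U + V)%VS].
Proof.
rewrite /outer_balanced sum_pair_family.
have outA : outer_space A = [set v | v \in U].
  by rewrite -[A]scale1r outer_space_wedge // oner_neq0.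
have outB : outer_space B = [set v | v \in V].
  by rewrite -[B]scale1r outer_space_wedge // oner_neq0.
set S := [set v | _].
suff -> : S = [set v | v \in (U + V)%VS] by [].
apply/seteqP; split => v /=.
  move=> [u [uAB ->]]; rewrite !big_ord_recl big_ord0 addr0; apply: memv_add.
    by have := uAB ord0; rewrite /pair_family /= outA.
  by have := uAB (lift ord0 ord0); rewrite /pair_family /= outB.
move=> /memv_addP[x xU [y yV ->]].
exists (fun i : 'I_2 => if i == 0 then x else y); split.
  by move=> i; rewrite /pair_family; case: ifP; rewrite ?outA ?outB.
by rewrite !big_ord_recl big_ord0 addr0.
Qed.

Let dimU : \dim U = p. Proof. by rewrite (eqP (free_of_wedge_neq0 s0)). Qed.
Let dimV : \dim V = p. Proof. by rewrite (eqP (free_of_wedge_neq0 t0)). Qed.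

Lemma dim_cap_lt : (\dim (U :&: V) < p)%N.
Proof.
rewrite ltn_neqAle -{2}dimU dimvS ?capvSl // andbT.
apply: contraNneq neq_st => dUV.
have eU : (U :&: V)%VS = U by apply/eqP; rewrite eqEdim capvSl dUV dimU /=.
have eV : (U :&: V)%VS = V by apply/eqP; rewrite eqEdim capvSr dUV dimV /=.
by rewrite -{1}eU eV.
Qed.

Lemma dim_add_cap : (\dim (U + V) + \dim (U :&: V) = p + p)%N.
Proof. by rewrite dimv_sum_cap dimU dimV. Qed.

Lemma add_blades_neq0 : A + B != 0.
Proof.
apply: contra neq_st; rewrite addr_eq0 => /eqP AB.
apply/eqP/vspaceP => v.
by rewrite (mem_span_wedge _ s0) (mem_span_wedge _ t0) AB mulrN oppr_eq0.
Qed.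

Lemma adjacent_blades : (\dim (U :&: V)).+1 = p ->
  [/\ simple_mv (A + B), ~ inner_balanced (pair_family A B)
    & ~ outer_balanced (pair_family A B)].
Proof.
set D := (U :&: V)%VS => dD.
pose r : seq X := vbasis D.
have sr : size r = \dim D by rewrite size_tuple.
have rD : <<r>>%VS = D := span_basis (vbasisP D).
have fr : free r := basis_free (vbasisP D).
have extend W : \dim W = p -> (D <= W)%VS ->
    exists x, [/\ x \in W, x \notin D & W = <<x :: r>>%VS].
  move=> dW DW.
  have [x xW xD] : exists2 x, x \in W & x \notin D.
    by apply/subvPn; apply/negP => /dimvS; rewrite dW -dD ltnn.
  exists x; split => //; apply/esym/eqP.
  have fxr : free (x :: r) by rewrite free_cons rD xD.
  rewrite eqEdim (eqP fxr) dW /= sr dD leqnn andbT.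
  by rewrite span_cons rD subv_add DW andbT -memvE.
have [x [xU xD Ux]] := extend _ dimU (capvSl _ _).
have [y [yV yD Vy]] := extend _ dimV (capvSr _ _).
have [|a a0 Aa] := wedge_eq_span _ Ux s0; first by rewrite /= sr dD.
have [|b b0 Bb] := wedge_eq_span _ Vy t0; first by rewrite /= sr dD.
(* A = a x ^ r and B = b y ^ r, so [z] is the vector left after factoring out the common part r. *)
pose z := a *: x + b *: y.
have ABz : A + B = wedge E (z :: r).
  by rewrite Aa Bb !wedge_cons /z linearD !linearZ mulrDl -!scalerAl.
have zV : z \notin V.
  rewrite /z (rpredDr _ (memvZ b yV)) rpredZeq (negPf a0) /=.
  by apply: contra xD => xV; rewrite memv_cap xU.
have zr0 : wedge E (z :: r) != 0 by rewrite -ABz add_blades_neq0.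
split.
- have zr : size (z :: r) == (\dim D).+1 by rewrite /= sr.
  by exists p; rewrite -dD ABz; exists (Tuple zr).
- rewrite inner_balanced_pairE ABz -[wedge E _]scale1r inner_space_wedge ?oner_neq0 //.
  move=> /mem_vspace_inj zrD; move: zV.
  have : z \in (U :&: V)%VS by rewrite -zrD memv_span ?mem_head.
  by rewrite memv_cap => /andP[_ ->].
rewrite outer_balanced_pairE ABz -[wedge E _]scale1r outer_space_wedge ?oner_neq0 //.
move=> /mem_vspace_inj zrD.
(* The space of A + B has dimension p, whereas U + V has dimension p + 1. *)
have := dim_add_cap; rewrite -zrD (eqP (free_of_wedge_neq0 zr0)) /= sr dD -/D.
by move=> /eqP; rewrite eqn_add2l -dD eqn_leq ltnn andbF.
Qed.

Hypothesis far : (\dim (U :&: V) + 2 <= p)%N.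

(* If v ^ A = - v ^ B is nonzero, it is a (p+1)-blade whose space contains    *)
(* both [A] and [B].                                                          *)
Lemma far_wedge_eq0 v : ext_in E v * (A + B) = 0 -> ext_in E v * A = 0.
Proof.
rewrite mulrDr => /eqP; rewrite addr_eq0 => /eqP vAB.
apply/eqP/negP => /negP vA0.
have vs0 : wedge E (v :: s) != 0 by rewrite wedge_cons.
have vst : wedge E (v :: s) = - wedge E (v :: t) by rewrite !wedge_cons.
have vt0 : wedge E (v :: t) != 0 by rewrite -oppr_eq0 -vst.
have spans : <<v :: s>>%VS = <<v :: t>>%VS.
  apply/vspaceP => x; rewrite (mem_span_wedge _ vs0) (mem_span_wedge _ vt0).
  by rewrite vst mulrN oppr_eq0.
have : (U + V <= <<v :: s>>)%VS.
  by rewrite subv_add {2}spans !span_cons !addvSr.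
move=> /dimvS; rewrite (eqP (free_of_wedge_neq0 vs0)) /= sizes => dUV.
(* The two bounds add up to 2p + 2 <= 2p + 1. *)
have := leq_add dUV far; rewrite addnA dim_add_cap addn2.
by rewrite addSn -addnS -addSnnS ltnn.
Qed.

(* If v -| A = - (v -| B) is nonzero, it is a (p-1)-blade whose space is that *)
(* of the vectors orthogonal to v in [A], and likewise in [B].                *)
Lemma far_lcontr_eq0 v : lcontr (ext_in E v) (A + B) = 0 ->
  lcontr (ext_in E v) A = 0.
Proof.
rewrite lcontrD => /eqP; rewrite addr_eq0 => /eqP vAB.
apply/eqP/negP => /negP vA0.
have vB0 : lcontr (ext_in E v) B != 0 by rewrite -oppr_eq0 -vAB.
have vs : v \notin orthov dot <<s>> by rewrite -(lcontr_wedge_eq0 _ s0).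
have vt : v \notin orthov dot <<t>> by rewrite -(lcontr_wedge_eq0 _ t0).
have [c [s' [c0 s'0 Us' vA]]] := lcontr_wedge s0 vs.
have [d [t' [d0 t'0 Vt' vB]]] := lcontr_wedge t0 vt.
(* Opposite multivectors have the same inner space, and for blades it is the span. *)
have spans : <<s'>>%VS = <<t'>>%VS.
  apply: mem_vspace_inj.
  rewrite -(inner_space_wedge c0 s'0) -(inner_space_wedge d0 t'0) -vA -vB vAB.
  by apply/seteqP; split => x /eqP xB; apply/eqP; move: xB;
    rewrite mulrN oppr_eq0.
have : (<<s'>> <= U :&: V)%VS.
  by rewrite subv_cap {2}spans Us' Vt' !capvSl.
move=> /dimvS; rewrite Us' -eq_dim_orthov1 // dimU => dUV.
(* This gives p.-1 + 2 <= p, absurd even for p = 0, where the predecessor is truncated. *)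
have := leq_trans (leq_add dUV (leqnn 2)) far.
by rewrite addn2 ltnNge leqSpred.
Qed.

(** Without cancellation, v annihilates A + B iff it annihilates both blades. For contraction this
    is orthogonality to both U and V, that is, to U + V, and taking complements gives the outer
    space. *)
Lemma far_blades_balanced : balanced (pair_family A B).
Proof.
split.
  rewrite inner_balanced_pairE; apply/seteqP; split => v; rewrite /inner_space /=.
    move=> vAB; have vA := far_wedge_eq0 vAB.
    move: vAB; rewrite mulrDr vA add0r => /eqP vB.
    by rewrite memv_cap (mem_span_wedge _ s0) (mem_span_wedge _ t0) vA vB eqxx.
  rewrite memv_cap (mem_span_wedge _ s0) (mem_span_wedge _ t0).
  by rewrite mulrDr => /andP[/eqP -> /eqP ->]; rewrite addr0.
rewrite outer_balanced_pairE -(orthogonal_to_orthov dot) /outer_space.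
congr orthogonal_to; apply/seteqP; split => v /=; rewrite mem_orthovD.
  move=> vAB; have vA := far_lcontr_eq0 vAB.
  move: vAB; rewrite lcontrD vA add0r => /eqP.
  by rewrite -(lcontr_wedge_eq0 _ s0) -(lcontr_wedge_eq0 _ t0) vA eqxx.
rewrite -!(lcontr_wedge_eq0 _ s0) -!(lcontr_wedge_eq0 _ t0).
by rewrite lcontrD => /andP[/eqP -> /eqP ->]; rewrite addr0.
Qed.

Lemma far_blades_not_simple : ~ simple_mv (A + B).
Proof.
move=> /simple_inner_outer_space/(_ add_blades_neq0).
have [/inner_balanced_pairE -> /outer_balanced_pairE ->] := far_blades_balanced.
move=> /mem_vspace_inj capD; have := dim_add_cap; rewrite -capD.
by move/eqP; rewrite ltn_eqF // -addnS leq_add ?dim_cap_lt // ltnW // dim_cap_lt.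
Qed.

End PairOfBlades.

Theorem proposition4p11 (R : realType) (k : geometry)
    (X : vectType (scalar_field R k)) (dot : {dot X for conj_scalar R k})
    (E : exteriorAlgebra dot) (p : nat) (A B : E)
    (bladeA : is_pblade p A) (bladeB : is_pblade p B)
    (A_neq0 : A != 0) (B_neq0 : B != 0)
    (neqAB : blade_space A != blade_space B) :
  [/\ (\dim (blade_space A :&: blade_space B) + 1)%N = p,
      (p + 1)%N = \dim (blade_space A + blade_space B),
      simple_mv (A + B),
      ~ inner_balanced (pair_family A B)
    & ~ outer_balanced (pair_family A B)]
  \/
  [/\ (\dim (blade_space A :&: blade_space B) + 2 <= p)%N,
      (p + 2 <= \dim (blade_space A + blade_space B))%N,
      ~ simple_mv (A + B)
    & balanced (pair_family A B)].
Proof.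
case: p bladeA bladeB => [[a Aa] [b Bb]|p [s As] [t Bt]].
  (* For p = 0 both blades are nonzero scalars, whose spaces are both zero, against [neqAB]. *)
  have a0 : a != 0 by apply: contraNneq A_neq0 => a0; rewrite Aa a0 scale0r.
  have b0 : b != 0 by apply: contraNneq B_neq0 => b0; rewrite Bb b0 scale0r.
  by rewrite Aa Bb !blade_space_scalar // eqxx in neqAB.
have ss := size_tuple s; have st := size_tuple t; subst A B.
move: neqAB; rewrite !blade_space_wedge // => neqAB.
have dsum := dim_add_cap ss st A_neq0 B_neq0.
have := dim_cap_lt ss st A_neq0 B_neq0 neqAB.
(* The grade is now p.+1: the intersection has dimension p or less than p, and [dsum] gives the
   dimension of the sum. *)
rewrite ltnS leq_eqVlt => /orP[/eqP dcap|dcap]; [left|right].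
  have [simpleAB ninner nouter] :=
    adjacent_blades ss st A_neq0 B_neq0 neqAB (congr1 S dcap).
  split; rewrite ?addn1 ?dcap //.
  by move/eqP: dsum; rewrite dcap addnS -addSn eqn_add2r => /eqP.
have far : (\dim (<<s>> :&: <<t>>) + 2 <= p.+1)%N by rewrite addn2.
split => //.
- by rewrite -(leq_add2r (\dim (<<s>> :&: <<t>>))) dsum -addnA leq_add2l addnC.
- exact: far_blades_not_simple ss st A_neq0 B_neq0 neqAB far.
exact: far_blades_balanced ss st A_neq0 B_neq0 far.
Qed.
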